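(* Let $(X,\mathcal A)$ be a measurable space. Let $\otimes\colon[0,1]^2\to[0,1]$ be a fuzzy conjunction and let $\star\colon[0,1]^2\to[0,1]$ be non-decreasing, left-continuous and such that $1\star0=0=0\star1$. Suppose that $\varphi_i\colon[0,1]\to[0,1]$ is continuous and increasing such that $\varphi_i(0)=0$ and $1\otimes\varphi_i(1)\le\varphi_i(1)$ for $i=1,2,3$. Then the following statements are equivalent: (i) $\varphi_1^{-1}(a\otimes\varphi_1(b\star c))\ge\big[\varphi_2^{-1}(a\otimes\varphi_2(b))\star\varphi_3^{-1}(1\otimes\varphi_3(c))\big]\vee\big[\varphi_2^{-1}(1\otimes\varphi_2(b))\star\varphi_3^{-1}(a\otimes\varphi_3(c))\big]$ for any $a,b,c\in[0,1]$; (ii) $\varphi_1^{-1}\big(\int_m^\otimes\varphi_1(f\star g)\big)\ge\varphi_2^{-1}\big(\int_m^\otimes\varphi_2(f)\big)\star\varphi_3^{-1}\big(\int_m^\otimes\varphi_3(g)\big)$ holds for any $\mathcal A$-measurable functions $f,g\colon X\to[0,1]$ comonotone on $X$ and any capacity $m$ on $(X,\mathcal A)$.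
   Context: $(X,\mathcal A)$ is a measurable space ($X$ non-empty, $\mathcal A$ a $\sigma$-algebra). A capacity is a set function $m\colon\mathcal A\to[0,1]$ with $m(\emptyset)=0$, $m(X)=1$ and $m(A)\le m(B)$ whenever $A\subset B$. A binary operation on $[0,1]$ is non-decreasing if it is non-decreasing in both arguments, and a non-decreasing one is left-continuous if it is left-continuous in each coordinate. A fuzzy conjunction is a non-decreasing operation $\otimes\colon[0,1]^2\to[0,1]$ with $1\otimes1=1$ and $0\otimes1=1\otimes0=0\otimes0=0$. ''Increasing'' (for functions of one variable) means strictly increasing; $\varphi_i^{-1}$ is the inverse function defined on $[0,\varphi_i(1)]$. $a\vee b=\max(a,b)$. $f\star g$ is taken pointwise and $\varphi(f)=\varphi\circ f$ is the composition. The q-integral of a measurable $f\colon X\to[0,1]$ with respect to a capacity $m$ is $\int_m^\otimes f=\sup_{t\in[0,1]}\{m(\{f\ge t\})\otimes t\}$, where $\{f\ge t\}=\{x\in X:f(x)\ge t\}$. Functions $f,g$ are comonotone on $X$ if $(f(x)-f(y))(g(x)-g(y))\ge0$ for all $x,y\in X$.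
   Formalization: The implication from (ii) to (i) is stated only when the σ-algebra contains a measurable set other than ∅ and X; otherwise it fails, e.g. for ⊗ the product, ⋆ the minimum and φ_i the identity. The implication from (i) to (ii) is for all measurable spaces. *)

(* Defs.v *)
From HB Require Import structures.
From mathcomp Require Import all_boot all_order all_algebra.
From mathcomp Require Import all_classical all_reals all_analysis.
Set Implicit Arguments.
Unset Strict Implicit.
Unset Printing Implicit Defensive.
Import Order.TTheory GRing.Theory Num.Theory.
Import numFieldNormedType.Exports.
Local Open Scope classical_set_scope.
Local Open Scope ring_scope.

(* Operations on [0,1] and functions [0,1] -> [0,1] are total functions on R of
   which only the restriction to [0,1] is ever constrained or used. *)

Definition binop01 (R : realType) (op : R -> R -> R) : Prop :=
  forall a b : R, a \in `[0, 1] -> b \in `[0, 1] -> op a b \in `[0, 1].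

Definition nondecreasing01 (R : realType) (op : R -> R -> R) : Prop :=
  forall a a' b b' : R,
    a \in `[0, 1] -> a' \in `[0, 1] -> b \in `[0, 1] -> b' \in `[0, 1] ->
    a <= a' -> b <= b' -> op a b <= op a' b'.

Definition left_continuous01 (R : realType) (op : R -> R -> R) : Prop :=
  forall a b : R, a \in `]0, 1] -> b \in `[0, 1] ->
    (op x b @[x --> a^'-] --> op a b) /\ (op b x @[x --> a^'-] --> op b a).

Definition fuzzy_conjunction (R : realType) (op : R -> R -> R) : Prop :=
  [/\ binop01 op, nondecreasing01 op, op 1 1 = 1 &
      [/\ op 0 1 = 0, op 1 0 = 0 & op 0 0 = 0]].

Definition scale01 (R : realType) (phi : R -> R) : Prop :=
  [/\ {in `[0, 1], forall x : R, phi x \in `[0, 1]},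
      {within `[0, 1], continuous phi},
      {in `[0, 1] &, {homo phi : x y / x < y}} &
      phi 0 = 0].

(* Inverse of the restriction of phi to [0,1]. *)
Definition inv01 (R : realType) (phi : R -> R) : R -> R :=
  'pinv_(fun=> 0) `[0, 1]%classic phi.

(* The sigma-algebra is not reduced to the empty set and the whole space.  If it
   is, all measurable functions are constant and all capacities are 0-1 valued,
   so that no q-integral inequality can bring in a number a \in ]0, 1[: with
   a (x) b = a * b, star = min and phi_i = id, qintegral_ineq below then holds
   while pointwise_ineq fails at a = c = 1/2, b = 1. *)
Definition nontrivial_sigma_algebra (d : measure_display)
    (X : measurableType d) : Prop :=
  exists A : set X, [/\ measurable A, A <> set0 & A <> setT].

(* Values of m on non-measurable sets are irrelevant. *)
Definition capacity (R : realType) (d : measure_display)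
    (X : measurableType d) (m : set X -> R) : Prop :=
  [/\ forall A : set X, measurable A -> m A \in `[0, 1],
      m set0 = 0, m setT = 1 &
      forall A B : set X, measurable A -> measurable B ->
        A `<=` B -> m A <= m B].

Definition measurable01 (R : realType) (d : measure_display)
    (X : measurableType d) (f : X -> R) : Prop :=
  measurable_fun setT f /\ forall x : X, f x \in `[0, 1].

Definition comonotone (R : realType) (X : Type) (f g : X -> R) : Prop :=
  forall x y : X, 0 <= (f x - f y) * (g x - g y).

Definition qintegral (R : realType) (d : measure_display)
    (X : measurableType d) (op : R -> R -> R) (m : set X -> R)
    (f : X -> R) : R :=
  sup [set op (m [set x | t <= f x]) t | t in `[0, 1]%classic].

Definition pointwise_ineq (R : realType) (otimes star : R -> R -> R)
    (phi1 phi2 phi3 : R -> R) : Prop :=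
  forall a b c : R, a \in `[0, 1] -> b \in `[0, 1] -> c \in `[0, 1] ->
    Num.max
      (star (inv01 phi2 (otimes a (phi2 b))) (inv01 phi3 (otimes 1 (phi3 c))))
      (star (inv01 phi2 (otimes 1 (phi2 b))) (inv01 phi3 (otimes a (phi3 c))))
    <= inv01 phi1 (otimes a (phi1 (star b c))).

Definition qintegral_ineq (R : realType) (d : measure_display)
    (X : measurableType d) (otimes star : R -> R -> R)
    (phi1 phi2 phi3 : R -> R) : Prop :=
  forall (f g : X -> R) (m : set X -> R),
    measurable01 f -> measurable01 g -> comonotone f g -> capacity m ->
    star (inv01 phi2 (qintegral otimes m (phi2 \o f)))
         (inv01 phi3 (qintegral otimes m (phi3 \o g)))
    <= inv01 phi1 (qintegral otimes m (phi1 \o (fun x => star (f x) (g x)))).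

(* Main.v *)
(* Writing [t = phi s], [inv01 phi (qintegral m (phi \o f))] is the supremum over
   [s] of [inv01 phi (otimes (m {f >= s}) (phi s))].  Since [star] is
   left-continuous, (ii) reduces to comparing the terms indexed by a pair
   [(s, t)]; comonotonicity nests the level sets [{f >= s}] and [{g >= t}], the
   smaller one is contained in [{star f g >= star s t}], and (i) applies with [a]
   the capacity of the smaller one.  Conversely, (i) is (ii) for a constant and a
   multiple of the indicator of a nontrivial measurable set of capacity [a]. *)

Require Import Defs.
From HB Require Import structures.
From mathcomp Require Import all_boot all_order all_algebra.
From mathcomp Require Import all_classical all_reals all_analysis.
Set Implicit Arguments.
Unset Strict Implicit.
Unset Printing Implicit Defensive.
Import Order.TTheory GRing.Theory Num.Theory.
Import numFieldNormedType.Exports.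
Local Open Scope classical_set_scope.
Local Open Scope ring_scope.

(** * The unit interval and the zeros of a fuzzy conjunction *)

Lemma in01_0 (R : realType) : (0 : R) \in `[0, 1].
Proof. by rewrite in_itv /= lexx ler01. Qed.

Lemma in01_1 (R : realType) : (1 : R) \in `[0, 1].
Proof. by rewrite in_itv /= lexx ler01. Qed.

(* [Hint Resolve] fails here: it does not unify the different canonical paths to
   the structures carrying [0], [1] and the order. *)
Local Hint Extern 0 (is_true (_ \in _)) =>
  solve [exact: in01_0 | exact: in01_1] : core.

Lemma in01_ge0 (R : realType) (a : R) : a \in `[0, 1] -> 0 <= a.
Proof. by rewrite in_itv => /andP[]. Qed.

Lemma in01_le1 (R : realType) (a : R) : a \in `[0, 1] -> a <= 1.
Proof. by rewrite in_itv => /andP[]. Qed.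

Lemma in01_eq0Vgt0 (R : realType) (a : R) : a \in `[0, 1] -> 0 = a \/ 0 < a.
Proof. by move=> /in01_ge0; rewrite le_eqVlt => /predU1P. Qed.

Lemma fuzzy_conjunction0r (R : realType) (op : R -> R -> R) (a : R) :
  fuzzy_conjunction op -> a \in `[0, 1] -> op a 0 = 0.
Proof.
move=> [op01 opnd _ [_ op10 _]] a01; apply/le_anti.
by rewrite (in01_ge0 (op01 _ _ _ _)) // -[leRHS]op10 opnd // (in01_le1 a01).
Qed.

Lemma fuzzy_conjunction0l (R : realType) (op : R -> R -> R) (a : R) :
  fuzzy_conjunction op -> a \in `[0, 1] -> op 0 a = 0.
Proof.
move=> [op01 opnd _ [op01_0 _ _]] a01; apply/le_anti.
by rewrite (in01_ge0 (op01 _ _ _ _)) // -[leRHS]op01_0 opnd // (in01_le1 a01).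
Qed.

(** * Scales and their inverses *)

Lemma scale01_in (R : realType) (phi : R -> R) (x : R) :
  scale01 phi -> x \in `[0, 1] -> phi x \in `[0, 1].
Proof. by move=> [phi01 _ _ _] /phi01. Qed.

Lemma scale01_le (R : realType) (phi : R -> R) (x y : R) :
  scale01 phi -> x \in `[0, 1] -> y \in `[0, 1] ->
  (phi x <= phi y) = (x <= y).
Proof.
move=> [_ _ phi_lt _] x01 y01; case: (leP x y) => [|yx].
  by rewrite le_eqVlt => /predU1P[->|/phi_lt/ltW->//]; rewrite lexx.
by apply/negbTE; rewrite -ltNge phi_lt.
Qed.

Lemma scale01_surj (R : realType) (phi : R -> R) (y : R) :
  scale01 phi -> 0 <= y <= phi 1 -> exists2 x, x \in `[0, 1] & phi x = y.
Proof.
move=> hphi /andP[y0 y1]; have [_ phi_c _ phi0] := hphi.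
apply: IVT => //; have phi1 : phi 0 <= phi 1 by rewrite scale01_le.
by rewrite (min_idPl phi1) (max_idPr phi1) phi0 y0.
Qed.

Lemma inv01K (R : realType) (phi : R -> R) (x : R) :
  scale01 phi -> x \in `[0, 1] -> inv01 phi (phi x) = x.
Proof.
move=> hphi x01; apply: pinvKV; last by rewrite inE.
move=> u v; rewrite !inE => u01 v01 uv.
by apply/le_anti/andP; split; rewrite -(scale01_le hphi) // uv.
Qed.

Lemma inv01_in (R : realType) (phi : R -> R) (y : R) :
  scale01 phi -> 0 <= y <= phi 1 -> inv01 phi y \in `[0, 1].
Proof. by move=> hphi /(scale01_surj hphi)[x x01 <-]; rewrite inv01K. Qed.

Lemma inv01_le (R : realType) (phi : R -> R) (y z : R) :
  scale01 phi -> 0 <= y <= phi 1 -> 0 <= z <= phi 1 ->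
  y <= z -> inv01 phi y <= inv01 phi z.
Proof.
move=> hphi /(scale01_surj hphi)[u u01 <-] /(scale01_surj hphi)[v v01 <-].
by rewrite !inv01K // scale01_le.
Qed.

(** * Level sets, comonotonicity and rational approximation from the left *)

Lemma measurable_level (R : realType) (d : measure_display)
    (X : measurableType d) (f : X -> R) (t : R) :
  measurable_fun setT f -> measurable [set x | t <= f x].
Proof.
move=> mf; have := mf measurableT `[t, +oo[%classic (measurable_itv _).
rewrite setTI; congr measurable; apply/seteqP; split => x /=;
  by rewrite in_itv /= andbT.
Qed.

Lemma measurable_level_lt (R : realType) (d : measure_display)
    (X : measurableType d) (f : X -> R) (t : R) :
  measurable_fun setT f -> measurable [set x | t < f x].
Proof.
move=> mf; have := mf measurableT `]t, +oo[%classic (measurable_itv _).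
rewrite setTI; congr measurable; apply/seteqP; split => x /=;
  by rewrite in_itv /= andbT.
Qed.

(** If both inclusions failed, there would be [x] and [y] with [f y < s <= f x] and
    [g x < t <= g y], which makes the product of the differences negative. *)
Lemma comonotone_level (R : realType) (X : Type) (f g : X -> R) (s t : R) :
  comonotone f g ->
  [set x | s <= f x] `<=` [set x | t <= g x] \/
  [set x | t <= g x] `<=` [set x | s <= f x].
Proof.
move=> fg; apply: contrapT => /not_orP[/existsNP[x /not_implyP[/= sfx tgx]]].
move=> /existsNP[y /not_implyP[/= tgy sfy]].
have := fg x y; apply/negP; rewrite -ltNge nmulr_llt0 ?subr_gt0 ?subr_lt0.
  by rewrite (lt_le_trans _ sfx) // ltNge; apply/negP.
by rewrite (lt_le_trans _ tgy) // ltNge; apply/negP.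
Qed.

(** Separate left-continuity suffices: [a] is first lowered to a rational [q], then [b] is lowered
    with [q] kept fixed. Rationals make the union over such pairs countable. *)
Lemma left_continuous01_gt (R : realType) (op : R -> R -> R) (a b u : R) :
  left_continuous01 op -> a \in `]0, 1] -> b \in `]0, 1] -> u < op a b ->
  exists q r : rat, [/\ ratr q \in `]0, a[, ratr r \in `]0, b[ &
                        u < op (ratr q) (ratr r)].
Proof.
have near_rat (h : R -> R) (z : R) : 0 < z -> h x @[x --> z^'-] --> h z ->
    u < h z -> exists q : rat, [/\ ratr q \in `]0, z[ & u < h (ratr q)].
  move=> z0 hz uz; have [/= e e0 He] := cvgr_gt _ hz _ uz.
  have : Num.max 0 (z - e) < z by rewrite gt_max z0 ltrBlDr ltrDl.
  move=> /rat_in_itvoo[q]; rewrite in_itv /= gt_max => /andP[/andP[q0 qe] qz].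
  exists q; split; first by rewrite in_itv /= q0.
  by apply: He => //=; rewrite gtr0_norm ?subr_gt0 // ltrBlDr addrC -ltrBlDr.
move=> op_lc a01 b01 uab.
have [a0 a1] : 0 < a /\ a <= 1 by move: a01; rewrite in_itv /= => /andP.
have [b0 b1] : 0 < b /\ b <= 1 by move: b01; rewrite in_itv /= => /andP.
have b01' : b \in `[0, 1] by rewrite in_itv /= ltW.
have [q [q01 uq]] := near_rat (op ^~ b) a a0 (op_lc a b a01 b01').1 uab.
have qa : ratr q < a by move: q01; rewrite in_itv /= => /andP[].
have q01' : ratr q \in `[(0:R), 1].
  move: q01; rewrite !in_itv /= => /andP[q0 _].
  by rewrite !ltW // (lt_le_trans qa).
have [r [r01 ur]] := near_rat (op (ratr q)) b b0 (op_lc b _ b01 q01').2 uq.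
by exists q, r.
Qed.

(** * Measurability of [star] applied pointwise *)

Section measurable_star.
Variables (R : realType) (d : measure_display) (X : measurableType d).
Variables (star : R -> R -> R).
Hypotheses (star01 : binop01 star) (star_nd : nondecreasing01 star).
Hypotheses (star_lc : left_continuous01 star).
Hypotheses (star10 : star 1 0 = 0) (star01_0 : star 0 1 = 0).

(* By monotonicity and left-continuity, [u < star (f x) (g x)] iff
   [u < star q r] for some rationals [q < f x] and [r < g x]; the annihilation
   [star a 0 = 0 = star 0 a] takes care of the points where [f] or [g] vanishes. *)
Lemma measurable01_star (f g : X -> R) :
  measurable01 f -> measurable01 g ->
  measurable01 (fun x => star (f x) (g x)).
Proof.
move=> [mf f01] [mg g01]; split; last by move=> x; exact: star01.
move=> mT.
apply: (measurability _ (measurable_realfun.RGenOInfty.measurableE R)) => //.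
move=> _ [_ [u ->] <-]; rewrite setTI.
(* Negative [u] is treated apart: where [f] or [g] vanishes, no rational of [[0, 1]] lies strictly
   below it, and the countable union would miss the point. *)
have [u0|u0] := ltP u 0.
  rewrite (_ : _ @^-1` _ = setT) //; apply/seteqP; split => // x _ /=.
  by rewrite in_itv /= andbT (lt_le_trans u0) // (in01_ge0 (star01 _ _)).
pose F (q r : rat) : set X := [set x |
  [/\ ratr q \in `[(0:R), 1], ratr r \in `[(0:R), 1],
      u < star (ratr q) (ratr r), ratr q < f x & ratr r < g x]].
rewrite (_ : _ @^-1` _ = \bigcup_q \bigcup_r F q r).
  apply: bigcupT_measurable_rat => q; apply: bigcupT_measurable_rat => r.
  have [[q01 r01 uqr]|nqr] := pselect [/\ ratr q \in `[(0:R), 1],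
      ratr r \in `[(0:R), 1] & u < star (ratr q) (ratr r)].
    rewrite (_ : F q r = [set x | ratr q < f x] `&` [set x | ratr r < g x]).
      by apply: measurableI; exact: measurable_level_lt.
    by apply/seteqP; split => x /= => [[]|[]].
  rewrite (_ : F q r = set0) //.
  by apply/seteqP; split => x //= [? ? ? _ _]; apply: nqr.
apply/seteqP; split => x /=; rewrite in_itv /= andbT; last first.
  move=> [q _ [r _ [q01 r01 uqr qf rg]]]; apply: (lt_le_trans uqr).
  by apply: star_nd => //; exact: ltW.
move=> ux.
have fx : f x \in `]0, 1].
  rewrite in_itv /= (in01_le1 (f01 x)) andbT lt_neqAle (in01_ge0 (f01 x)) andbT.
  apply: contraTN ux => /eqP <-; rewrite -leNgt (le_trans _ u0) //.
  by rewrite -[leRHS]star01_0 star_nd // (in01_le1 (g01 x)).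
have gx : g x \in `]0, 1].
  rewrite in_itv /= (in01_le1 (g01 x)) andbT lt_neqAle (in01_ge0 (g01 x)) andbT.
  apply: contraTN ux => /eqP <-; rewrite -leNgt (le_trans _ u0) //.
  by rewrite -[leRHS]star10 star_nd // (in01_le1 (f01 x)).
have [q [r []]] := left_continuous01_gt star_lc fx gx ux.
rewrite !in_itv /= => /andP[q0 qf] /andP[r0 rg] uqr.
exists q => //; exists r => //; split=> //; rewrite in_itv /= !ltW //.
  by rewrite (lt_le_trans qf) // (in01_le1 (f01 x)).
by rewrite (lt_le_trans rg) // (in01_le1 (g01 x)).
Qed.

End measurable_star.

(** * The q-integral of step functions and of scaled functions *)

Section qintegral.
Variables (R : realType) (d : measure_display) (X : measurableType d).
Variables (otimes : R -> R -> R) (m : set X -> R).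
Hypotheses (hotimes : fuzzy_conjunction otimes) (hm : capacity m).

Let otimes_nd : nondecreasing01 otimes. Proof. by case: hotimes. Qed.
Let otimes01 : binop01 otimes. Proof. by case: hotimes. Qed.

Lemma capacity_level01 (f : X -> R) (t : R) :
  measurable_fun setT f -> m [set x | t <= f x] \in `[0, 1].
Proof. by move=> mf; case: hm => + _ _ _; apply; exact: measurable_level. Qed.

(** The level set at [t] is [A] for [0 < t <= u] and empty for larger [t]; the terms at [0] and
    above [u] vanish, so the supremum is attained at [u]. *)
Lemma qintegral_step (A : set X) (u : R) (h : X -> R) :
  measurable A -> u \in `[0, 1] ->
  (forall x, A x -> h x = u) -> (forall x, ~ A x -> h x = 0) ->
  qintegral otimes m h = otimes (m A) u.
Proof.
move=> mA u01 hA hNA; have [m01 m0 mT m_le] := hm.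
have levelA t : 0 < t <= u -> [set x | t <= h x] = A.
  move=> /andP[t0 tu]; apply/seteqP; split => x /=; last by move=> /hA ->.
  by move=> thx; apply: contrapT => /hNA hx0; move: thx; rewrite hx0 leNgt t0.
have h0 x : 0 <= h x.
  have [/hA ->|/hNA -> //] := pselect (A x); exact: in01_ge0.
have level0 : [set x | 0 <= h x] = setT.
  by apply/seteqP; split => // x _; exact: h0.
have mA01 := m01 _ mA.
have ub : ubound [set otimes (m [set x | t <= h x]) t | t in `[0, 1]%classic]
    (otimes (m A) u).
  move=> _ [t /= t01 <-].
  have [<-|t0] := in01_eq0Vgt0 t01.
    by rewrite level0 mT fuzzy_conjunction0r // (in01_ge0 (otimes01 _ _)).
  have [tu|ut] := leP t u; first by rewrite levelA ?t0 //; exact: otimes_nd.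
  rewrite (_ : [set x | t <= h x] = set0).
    by rewrite m0 fuzzy_conjunction0l // (in01_ge0 (otimes01 _ _)).
  apply/seteqP; split => x //= thx.
  have [/hA hxu|/hNA hx0] := pselect (A x).
    by move: thx; rewrite hxu leNgt ut.
  by move: thx; rewrite hx0 leNgt t0.
apply/le_anti/andP; split.
  by apply: ge_sup => //; apply/image_nonempty; exists 0; exact: in01_0.
apply: ub_le_sup; first by exists (otimes (m A) u).
(* For [u = 0] the level set at [u] is the whole space, not [A], but a second factor [0] makes both
   values [0]. *)
have [u0|u0] := in01_eq0Vgt0 u01.
  by exists 0; [exact: in01_0|rewrite level0 -u0 !fuzzy_conjunction0r ?mT].
by exists u => //; rewrite levelA // u0 lexx.
Qed.

Section scaled.
Variables (phi : R -> R) (f : X -> R).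
Hypotheses (hphi : scale01 phi) (phi1 : otimes 1 (phi 1) <= phi 1).
Hypothesis mf : measurable01 f.

(** Monotonicity bounds the value by [otimes 1 (phi 1)], hence by [phi 1]: it stays in the range of
    [phi], where [inv01 phi] is a true inverse. *)
Lemma otimes_scale_itv (a b : R) : a \in `[0, 1] -> b \in `[0, 1] ->
  0 <= otimes a (phi b) <= phi 1.
Proof.
move=> a01 b01.
have phib : phi b <= phi 1 by rewrite scale01_le // in01_le1.
apply/andP; split; first exact: in01_ge0 (otimes01 a01 (scale01_in hphi b01)).
apply: le_trans phi1.
by apply: otimes_nd => //; first [exact: scale01_in|exact: in01_le1].
Qed.

Lemma otimes_level_itv (s : R) : s \in `[0, 1] ->
  0 <= otimes (m [set x | s <= f x]) (phi s) <= phi 1.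
Proof.
by move=> s01; apply: otimes_scale_itv => //; apply: capacity_level01; case: mf.
Qed.

Lemma level_scale (s : R) : s \in `[0, 1] ->
  [set x | phi s <= (phi \o f) x] = [set x | s <= f x].
Proof.
move=> s01; have [_ f01] := mf.
by apply/seteqP; split => x /=; rewrite scale01_le.
Qed.

(** The substitution [t = phi s] covers [t <= phi 1]. Beyond [phi 1] the level set is empty and the
    term is [0], so [s = 0] will do. *)
Lemma qintegral_scale_term (t : R) : t \in `[0, 1] ->
  exists2 s, s \in `[0, 1] & otimes (m [set x | t <= (phi \o f) x]) t
                             <= otimes (m [set x | s <= f x]) (phi s).
Proof.
move=> t01; have [_ f01] := mf; have [tphi|phit] := leP t (phi 1).
  have [|s s01 <-] := @scale01_surj _ _ t hphi; first by rewrite in01_ge0.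
  by exists s => //; rewrite level_scale.
exists 0 => //; rewrite (_ : [set x | t <= (phi \o f) x] = set0).
  have [_ -> _ _] := hm; rewrite fuzzy_conjunction0l //.
  by have /andP[] := otimes_level_itv (in01_0 R).
apply/seteqP; split => x //=; apply/negP; rewrite -ltNge (le_lt_trans _ phit) //.
by rewrite scale01_le // in01_le1.
Qed.

Lemma qintegral_scale_ge (s : R) : s \in `[0, 1] ->
  otimes (m [set x | s <= f x]) (phi s) <= qintegral otimes m (phi \o f).
Proof.
move=> s01; apply: ub_le_sup.
  exists (phi 1) => _ [t /= t01 <-].
  have [s' s'01 /le_trans] := qintegral_scale_term t01; apply.
  by have /andP[] := otimes_level_itv s'01.
by exists (phi s); [exact: scale01_in|rewrite level_scale].
Qed.

Lemma qintegral_scale_itv : 0 <= qintegral otimes m (phi \o f) <= phi 1.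
Proof.
apply/andP; split.
  apply: le_trans (qintegral_scale_ge (in01_0 R)).
  by have /andP[] := otimes_level_itv (in01_0 R).
apply: ge_sup => [|_ [t /= t01 <-]].
  by apply/image_nonempty; exists 0; exact: in01_0.
have [s s01 /le_trans] := qintegral_scale_term t01; apply.
by have /andP[] := otimes_level_itv s01.
Qed.

(** Passes a bound from the terms to the supremum without continuity of [otimes]. Let [x] be the
    inverse image of the integral. For [w < x] some term exceeds [phi w], whence [h w <= k]; then
    [w] tends to [x] from the left. *)
Lemma inv01_qintegral_le (h : R -> R) (k : R) :
  {in `[0, 1] &, {homo h : x y / x <= y}} ->
  (forall x, x \in `]0, 1] -> h y @[y --> x^'-] --> h x) ->
  (forall s, s \in `[0, 1] ->
     h (inv01 phi (otimes (m [set x | s <= f x]) (phi s))) <= k) ->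
  h (inv01 phi (qintegral otimes m (phi \o f))) <= k.
Proof.
move=> h_nd h_lc hk; have [_ _ phi_lt phi0] := hphi.
have [x x01 phix] := scale01_surj hphi qintegral_scale_itv.
rewrite -phix inv01K //.
(* At [x = 0] there is no left limit inside the interval, but the term for [s = 0] has value [0] and
   gives the bound directly. *)
have [<-|x0] := in01_eq0Vgt0 x01.
  have inv0 : inv01 phi 0 = 0 by rewrite -[in LHS]phi0 inv01K.
  have := hk 0 (in01_0 R); rewrite phi0 fuzzy_conjunction0r ?inv0 //.
  by apply: capacity_level01; case: mf.
have xl : x \in `]0, 1] by rewrite in_itv /= x0 in01_le1.
apply: (cvgr_to_le (h_lc x xl)); near=> w.
have w0 : 0 < w by near: w; exact: nbhs_left_gt.
have wx : w < x by near: w; exact: nbhs_left_lt.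
have w01 : w \in `[0, 1].
  by rewrite in_itv /= ltW //= ltW // (lt_le_trans wx) ?in01_le1.
have := phi_lt _ _ w01 x01 wx; rewrite phix => /sup_gt[].
  by apply/image_nonempty; exists 0; exact: in01_0.
move=> _ [t /= t01 <-] wt.
have [s s01 ts] := qintegral_scale_term t01.
have itv := otimes_level_itv s01.
apply: le_trans (hk s s01); apply: h_nd => //; first exact: inv01_in.
rewrite -(inv01K hphi w01) inv01_le //; last exact: ltW (lt_le_trans wt ts).
by rewrite (in01_ge0 (scale01_in hphi w01)) scale01_le // in01_le1.
Unshelve. all: by end_near.
Qed.

End scaled.
End qintegral.

(** * From the pointwise inequality to the integral inequality *)

Lemma pointwise_qintegral_ineq (R : realType) (d : measure_display)
    (X : measurableType d) (otimes star : R -> R -> R)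
    (phi1 phi2 phi3 : R -> R) :
  fuzzy_conjunction otimes ->
  binop01 star -> nondecreasing01 star -> left_continuous01 star ->
  star 1 0 = 0 -> star 0 1 = 0 ->
  scale01 phi1 -> scale01 phi2 -> scale01 phi3 ->
  otimes 1 (phi1 1) <= phi1 1 ->
  otimes 1 (phi2 1) <= phi2 1 ->
  otimes 1 (phi3 1) <= phi3 1 ->
  pointwise_ineq otimes star phi1 phi2 phi3 ->
  qintegral_ineq X otimes star phi1 phi2 phi3.
Proof.
move=> hot star01 star_nd star_lc star10 star01_0 h1 h2 h3 h11 h21 h31 pw.
move=> f g m mf mg fg hm.
have [_ ot_nd _ _] := hot; have [m01 _ _ m_le] := hm.
have mF t := measurable_level t mf.1; have mG t := measurable_level t mg.1.
have msf := measurable01_star star01 star_nd star_lc star10 star01_0 mf mg.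
pose I3 := inv01 phi3 (qintegral otimes m (phi3 \o g)).
have I301 : I3 \in `[0, 1] by apply: inv01_in => //; exact: qintegral_scale_itv.
(* The two integrals are replaced by single terms one at a time: here the first, with the second
   frozen at [I3]. *)
apply: (inv01_qintegral_le hot hm h2 h21 mf (h := star ^~ I3)) => //.
- by move=> x y x01 y01 xy; exact: star_nd.
- by move=> x x01; exact: (star_lc x I3 x01 I301).1.
move=> s s01; set a := inv01 phi2 _.
have a01 : a \in `[0, 1].
  by apply: inv01_in => //; apply: otimes_scale_itv => //; exact: m01.
apply: (inv01_qintegral_le hot hm h3 h31 mg (h := star a)) => //.
- by move=> x y x01 y01 xy; exact: star_nd.
- by move=> x x01; exact: (star_lc x a x01 a01).2.
move=> t t01.
have st01 : star s t \in `[0, 1] by exact: star01.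
(* The smaller of the two nested level sets lies in the level set of [star f g],
   while the capacity of the larger one is bounded by [1]. *)
have key A : measurable A ->
    A `<=` [set x | s <= f x] -> A `<=` [set x | t <= g x] ->
    inv01 phi1 (otimes (m A) (phi1 (star s t))) <=
    inv01 phi1 (qintegral otimes m (phi1 \o (fun x => star (f x) (g x)))).
  move=> mA Af Ag; have mA01 := m01 _ mA; apply: inv01_le => //.
  - exact: otimes_scale_itv.
  - exact: qintegral_scale_itv.
  apply: le_trans (qintegral_scale_ge hot hm h1 h11 msf st01).
  have mS := measurable_level (star s t) msf.1.
  apply: ot_nd => //; try first [exact: m01|exact: scale01_in].
  apply: m_le => // x Ax /=; have [? ?] := (mf.2 x, mg.2 x).
  by apply: star_nd => //; [exact: Af|exact: Ag].
have top (phi : R -> R) (b u : R) : scale01 phi -> otimes 1 (phi 1) <= phi 1 ->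
    b \in `[0, 1] -> u \in `[0, 1] ->
    inv01 phi (otimes b (phi u)) <= inv01 phi (otimes 1 (phi u)).
  move=> hphi hphi1 b01 u01.
  apply: inv01_le => //; try exact: otimes_scale_itv.
  by apply: ot_nd => //; first [exact: scale01_in|exact: in01_le1].
have inv_in (phi : R -> R) (b u : R) : scale01 phi -> otimes 1 (phi 1) <= phi 1 ->
    b \in `[0, 1] -> u \in `[0, 1] -> inv01 phi (otimes b (phi u)) \in `[0, 1].
  by move=> *; apply: inv01_in => //; exact: otimes_scale_itv.
have mF01 := m01 _ (mF s); have mG01 := m01 _ (mG t).
(* The direction of the inclusion decides which entry of the maximum is used: the first when the
   level set of [f] is the smaller one, the second otherwise. *)
have [sub|sub] := comonotone_level s t fg.
  apply: le_trans (key _ (mF s) (fun _ => id) sub).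
  have := pw _ _ _ mF01 s01 t01; rewrite ge_max => /andP[+ _].
  apply: le_trans; apply: star_nd => //; try exact: inv_in.
  exact: top.
apply: le_trans (key _ (mG t) sub (fun _ => id)).
have := pw _ _ _ mG01 s01 t01; rewrite ge_max => /andP[_].
apply: le_trans; apply: star_nd => //; try exact: inv_in.
exact: top.
Qed.

(** * From the integral inequality to the pointwise one *)

Definition capacity_const (R : realType) (X : Type) (a : R) (B : set X) : R :=
  if B == set0 then 0 else if B == setT then 1 else a.

(** A point of [X] separates [setT] from [set0]; otherwise the first test in [capacity_const] would
    give the whole space the value [0]. *)
Lemma capacity_constP (R : realType) (d : measure_display)
    (X : measurableType d) (a : R) :
  (exists x : X, True) -> a \in `[0, 1] -> capacity (@capacity_const R X a).
Proof.
move=> [x0 _] a01.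
have T0 : (setT == set0 :> set X) = false.
  by apply/negbTE/eqP => /seteqP[/(_ x0 I)].
have c01 B : @capacity_const R X a B \in `[0, 1].
  by rewrite /capacity_const; do 2 case: ifP => // _.
split=> //; [by rewrite /capacity_const eqxx|by rewrite /capacity_const T0 eqxx|].
move=> A B _ _ AB; rewrite {1}/capacity_const.
case: (eqVneq A set0) => [_|A0]; first exact: in01_ge0.
have B0 : B != set0.
  by apply: contra_neq A0 => B0; apply/seteqP; split => //; rewrite -B0.
rewrite /capacity_const (negbTE B0).
case: (eqVneq A setT) => [AT|_].
  by rewrite (_ : B == setT) //; apply/eqP/seteqP; split => //; rewrite -AT.
by case: ifP => // _; exact: in01_le1.
Qed.

Lemma qintegral_pointwise_ineq (R : realType) (d : measure_display)
    (X : measurableType d) (otimes star : R -> R -> R)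
    (phi1 phi2 phi3 : R -> R) :
  fuzzy_conjunction otimes -> binop01 star -> nondecreasing01 star ->
  star 1 0 = 0 -> star 0 1 = 0 ->
  scale01 phi1 -> scale01 phi2 -> scale01 phi3 ->
  nontrivial_sigma_algebra X ->
  qintegral_ineq X otimes star phi1 phi2 phi3 ->
  pointwise_ineq otimes star phi1 phi2 phi3.
Proof.
move=> hot star01 star_nd star10 star01_0 h1 h2 h3 [A [mA A0 AT]] qi.
move=> a b c a01 b01 c01.
have star0r (u : R) : u \in `[0, 1] -> star u 0 = 0.
  move=> u01; apply/le_anti; rewrite (in01_ge0 (star01 _ _ _ _)) // andbT.
  by rewrite -[leRHS]star10 star_nd // in01_le1.
have star0l (u : R) : u \in `[0, 1] -> star 0 u = 0.
  move=> u01; apply/le_anti; rewrite (in01_ge0 (star01 _ _ _ _)) // andbT.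
  by rewrite -[leRHS]star01_0 star_nd // in01_le1.
pose m := @capacity_const R X a.
have hm : capacity m.
  by apply: capacity_constP => //; have /eqP/set0P[x _] := A0; exists x.
have mAa : m A = a by rewrite /m /capacity_const; do 2 case: eqP => // _.
have mT1 : m setT = 1 by case: hm.
pose step (u : R) : X -> R := fun x => if x \in A then u else 0.
have stepA u x : A x -> step u x = u by rewrite /step => /mem_set ->.
have stepNA u x : ~ A x -> step u x = 0 by move=> nAx; rewrite /step memNset.
have step01 (u : R) : u \in `[0, 1] -> measurable01 (step u).
  move=> u01; split; last by move=> x; rewrite /step; case: ifP.
  apply: measurable_fun_ifT => //; apply: (measurable_fun_bool true).
  rewrite setTI (_ : _ @^-1` _ = A) //.
  by apply/seteqP; split => x /=; [exact: set_mem|exact: mem_set].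
have cst01 (u : R) : u \in `[0, 1] -> measurable01 (fun _ : X => u) by [].
have int_cst (phi : R -> R) u : scale01 phi -> u \in `[0, 1] ->
    qintegral otimes m (phi \o (fun=> u)) = otimes 1 (phi u).
  (* A constant is a step function carried by the whole space, whose capacity is [1]. *)
  move=> hphi u01; rewrite -mT1.
  by apply: qintegral_step => //; [exact: scale01_in|move=> x; case].
have int_step (phi : R -> R) (h : X -> R) u : scale01 phi -> u \in `[0, 1] ->
    (forall x, A x -> h x = u) -> (forall x, ~ A x -> h x = 0) ->
    qintegral otimes m (phi \o h) = otimes a (phi u).
  move=> hphi u01 hA hNA; rewrite -mAa.
  apply: qintegral_step => //; first exact: scale01_in.
    by move=> x Ax /=; rewrite hA.
  by move=> x Ax /=; rewrite hNA //; case: hphi.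
rewrite ge_max; apply/andP; split.
(* A constant is comonotone with every function, and [star 0 c = 0] makes [star] of the two
   functions again a step on [A], of height [star b c]. *)
- have := qi (step b) (fun=> c) m (step01 b b01) (cst01 c c01).
  rewrite int_cst // (int_step _ _ b h2 b01 (stepA b) (stepNA b)).
  rewrite (int_step _ (fun x => star (step b x) c) (star b c)) //.
  + by apply => // x y; rewrite subrr mulr0.
  + exact: star01.
  + by move=> x Ax; rewrite stepA.
  + by move=> x Ax; rewrite stepNA // star0l.
- have := qi (fun=> b) (step c) m (cst01 b b01) (step01 c c01).
  rewrite int_cst // (int_step _ _ c h3 c01 (stepA c) (stepNA c)).
  rewrite (int_step _ (fun x => star b (step c x)) (star b c)) //.
  + by apply => // x y; rewrite subrr mul0r.
  + exact: star01.
  + by move=> x Ax; rewrite stepA.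
  + by move=> x Ax; rewrite stepNA // star0r.
Qed.

Theorem corollary4p1 (R : realType) (d : measure_display)
    (X : measurableType d) (otimes star : R -> R -> R)
    (phi1 phi2 phi3 : R -> R)
    (hotimes : fuzzy_conjunction otimes)
    (hstar01 : binop01 star)
    (hstar_nd : nondecreasing01 star)
    (hstar_lc : left_continuous01 star)
    (hstar10 : star 1 0 = 0) (hstar01_0 : star 0 1 = 0)
    (hphi1 : scale01 phi1) (hphi2 : scale01 phi2) (hphi3 : scale01 phi3)
    (hphi1_1 : otimes 1 (phi1 1) <= phi1 1)
    (hphi2_1 : otimes 1 (phi2 1) <= phi2 1)
    (hphi3_1 : otimes 1 (phi3 1) <= phi3 1) :
  (pointwise_ineq otimes star phi1 phi2 phi3 ->
     qintegral_ineq X otimes star phi1 phi2 phi3) /\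
  (nontrivial_sigma_algebra X ->
     qintegral_ineq X otimes star phi1 phi2 phi3 ->
     pointwise_ineq otimes star phi1 phi2 phi3).
Proof.
split; first exact: pointwise_qintegral_ineq.
exact: qintegral_pointwise_ineq.
Qed.
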